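(* Let $X$ be a shift space, $Y$ an irreducible shift of finite type with $h(X) < h(Y)$, and $\phi : X \to Y$ a bi-closing code. Let $d = \max \{ |\phi^{-1}(y)| : y \in Y \}$. \begin{enumerate} \item If $X$ is an indecomposable shift of finite type, then for all $n \geq d$ there exist an irreducible shift of finite type $\tilde X \supset X$ and an $n$-to-1, onto code $\tilde \phi : \tilde X \to Y$ which extends $\phi$ (i.e. $\tilde\phi|_X=\phi$). \item If $X$ is a shift of finite type, then for all $n \geq d+1$ there exist an irreducible shift of finite type $\tilde X \supset X$ and an $n$-to-1, onto code $\tilde \phi : \tilde X \to Y$ which extends $\phi$. \item If $X$ is an arbitrary shift space, then there is some $m \geq d$ such that for all $n \geq m$ there exist an irreducible shift of finite type $\tilde X \supset X$ and an $n$-to-1, onto code $\tilde \phi : \tilde X \to Y$ which extends $\phi$. \end{enumerate}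
   Context: A shift space (or subshift) is a closed shift-invariant subset of a full shift $\mathcal{A}^{\mathbb{Z}}$ over a finite alphabet $\mathcal{A}$. The alphabet of $\tilde X$ may be larger than that of $X$. A subshift is indecomposable if it is not the union of two disjoint nonempty subshifts, and irreducible if it has a dense forward orbit. $h(X)$ denotes the topological entropy of $X$. A code is a continuous shift-commuting map between shift spaces (not necessarily onto); a conjugacy is a bijective code. For a finite directed graph $G$ (loops and multiple edges allowed), the edge shift $\mathsf{X}_G$ is the set of all bi-infinite trips on $G$, i.e. sequences $(x_i)_{i\in\mathbb{Z}}$ of edges such that the terminal vertex of $x_i$ is the initial vertex of $x_{i+1}$ for all $i$. A shift of finite type is a subshift conjugate to an edge shift. Two points $x,x'$ are left (resp. right) asymptotic if there is $N\in\mathbb{Z}$ with $x_i=x'_i$ for all $i\le N$ (resp. all $i\ge N$). A code is right closing (resp. left closing) if it never maps two distinct left (resp. right) asymptotic points to the same point, and bi-closing if it is both left and right closing. For a positive integer $n$, a code is $n$-to-1 if every point of its codomain has exactly $n$ preimages. *)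

(* Defs.v *)
From HB Require Import structures.
From mathcomp Require Import all_boot all_order all_algebra.
From mathcomp Require Import all_classical all_reals all_analysis.

Set Implicit Arguments.
Unset Strict Implicit.
Unset Printing Implicit Defensive.

Import Order.TTheory GRing.Theory Num.Theory.

Local Open Scope classical_set_scope.
Local Open Scope card_scope.
Local Open Scope ring_scope.

Notation fullshift A := (prod_topology (fun _ : int => discrete_topology A)).

Definition shift_map (A : finType) (x : fullshift A) : fullshift A :=
  fun i => x (i + 1).

(* The empty set is a subshift. *)
Definition subshift (A : finType) (X : set (fullshift A)) : Prop :=
  closed X /\ @shift_map A @` X = X.

Definition indecomposable (A : finType) (X : set (fullshift A)) : Prop :=
  ~ exists X1 X2 : set (fullshift A),
      [/\ subshift X1, subshift X2, X1 !=set0, X2 !=set0 &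
          X1 `&` X2 = set0 /\ X1 `|` X2 = X].

Definition irreducible (A : finType) (X : set (fullshift A)) : Prop :=
  exists2 x, X x & closure (range (fun n => iter n (@shift_map A) x)) = X.

(* A code X -> Y is represented by a function between the ambient full shifts;
   its values outside X are irrelevant. *)
Definition is_code (A B : finType) (X : set (fullshift A)) (Y : set (fullshift B))
    (f : fullshift A -> fullshift B) : Prop :=
  [/\ set_fun X Y f, {within X, continuous f} &
      forall x, X x -> f (shift_map x) = shift_map (f x)].

Definition conjugacy (A B : finType) (X : set (fullshift A))
    (Y : set (fullshift B)) (f : fullshift A -> fullshift B) : Prop :=
  is_code X Y f /\ set_bij X Y f.

(* Finite directed multigraphs: loops and parallel edges are allowed. *)
Record digraph := Digraph {
  vertex : finType;
  edge : finType;
  initial : edge -> vertex;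
  terminal : edge -> vertex }.

Arguments initial {G} e : rename.
Arguments terminal {G} e : rename.

Definition edge_shift (G : digraph) : set (fullshift (edge G)) :=
  [set x | forall i : int, terminal (x i) = initial (x (i + 1))].
Arguments edge_shift : clear implicits.

Definition shift_of_finite_type (A : finType) (X : set (fullshift A)) : Prop :=
  subshift X /\
  exists (G : digraph) (f : fullshift A -> fullshift (edge G)),
    conjugacy X (edge_shift G) f.

Definition left_asymptotic (A : finType) (x x' : fullshift A) : Prop :=
  exists N : int, forall i : int, i <= N -> x i = x' i.

Definition right_asymptotic (A : finType) (x x' : fullshift A) : Prop :=
  exists N : int, forall i : int, N <= i -> x i = x' i.

Definition right_closing (A B : finType) (X : set (fullshift A))
    (f : fullshift A -> fullshift B) : Prop :=
  forall x x', X x -> X x' -> x <> x' -> left_asymptotic x x' -> f x <> f x'.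

Definition left_closing (A B : finType) (X : set (fullshift A))
    (f : fullshift A -> fullshift B) : Prop :=
  forall x x', X x -> X x' -> x <> x' -> right_asymptotic x x' -> f x <> f x'.

Definition bi_closing (A B : finType) (X : set (fullshift A))
    (f : fullshift A -> fullshift B) : Prop :=
  left_closing X f /\ right_closing X f.

Definition fiber (A B : finType) (X : set (fullshift A))
    (f : fullshift A -> fullshift B) (y : fullshift B) : set (fullshift A) :=
  X `&` f @^-1` [set y].

Definition n_to_1 (A B : finType) (X : set (fullshift A))
    (Y : set (fullshift B)) (n : nat) (f : fullshift A -> fullshift B) : Prop :=
  forall y, Y y -> fiber X f y #= `I_n.

Definition max_fiber_card (A B : finType) (X : set (fullshift A))
    (Y : set (fullshift B)) (f : fullshift A -> fullshift B) (d : nat) : Prop :=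
  (exists2 y, Y y & fiber X f y #= `I_d) /\
  (forall y, Y y -> fiber X f y #<= `I_d).

Definition nb_blocks (A : finType) (X : set (fullshift A)) (n : nat) : nat :=
  #|[pred w : n.-tuple A | `[< exists2 x, X x &
      exists i : int, forall k : 'I_n, x (i + k%:Z) = tnth w k >] ]|.

(* Exponential growth rate of the number of blocks; it lives in \bar R because
   the empty subshift has entropy -oo (lne 0 = -oo). *)
Definition entropy (R : realType) (A : finType) (X : set (fullshift A)) :
    \bar R :=
  limn (fun n : nat =>
    (lne ((nb_blocks X n)%:R : R)%:E * ((n%:R : R)^-1)%:E)%E).

(* X is included in X' through an injective renaming iota of its alphabet into
   the (possibly larger) alphabet A' of X'. *)
Definition has_n_to_1_extension (A B : finType) (X : set (fullshift A))
    (Y : set (fullshift B)) (phi : fullshift A -> fullshift B) (n : nat) :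
    Prop :=
  exists (A' : finType) (iota : A -> A') (X' : set (fullshift A'))
         (phi' : fullshift A' -> fullshift B),
    [/\ injective iota /\ (forall x, X x -> X' (fun i => iota (x i))),
        shift_of_finite_type X' /\ irreducible X',
        is_code X' Y phi',
        n_to_1 X' Y n phi' /\ set_surj X' Y phi' &
        forall x, X x -> phi' (fun i => iota (x i)) = phi x].

(* Main.v *)
Require Import Defs.
From mathcomp Require Import all_boot all_order all_algebra all_fingroup.
From mathcomp Require Import all_classical all_reals all_analysis.
From mathcomp Require Import zify.

(** Why the theorem holds.  The model of an [n]-to-1 extension of [Y] is a skew
    product: points are pairs of a point [y] of [Y] and a sheet [s] among [n], and
    the shift acts by [(y, s) |-> (shift y, c y s)], where [c] is a locally
    constant function from [Y] to the permutations of the sheets.  When [Y] is an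
    edge shift and [c y] depends only on the edge [y 0], this is the edge shift of
    an [n]-sheeted covering graph, so it is of finite type and exactly [n]-to-1
    over [Y].  It therefore suffices to embed [X] over [Y] in such a skew product
    and to make the latter irreducible, for each positive [n] bounding the
    cardinals of the fibres of [phi]; the three parts of the theorem are instances
    of this single construction.

    An embedding over [Y] amounts to a locally constant labelling
    [k : X -> 'I_n], injective on each fibre, together with a cocycle [c] such
    that [c (phi x) (k x) = k (shift x)].
    - By compactness, the two closing conditions give an [N] such that points of
      one fibre are told apart by their central window of radius [N]
      ([fiber_separated]).  Moreover the fibre over a point near [y] lies near
      the fibre over [y] ([fiber_usc]).  Hence fibres near that of [y] embed in
      it, and numberings of finitely many fibres yield [k]
      ([fiber_labelling]).
    - The same semicontinuity shows that the partial injections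
      [k x |-> k (shift x)] over points near [y] are restrictions of the one over
      [y].  Completing the latter to a permutation gives [c]
      ([label_cocycle]).

    Codes do not raise entropy, so [phi] is not onto
    ([entropy_lt_not_onto]).  Hence some cylinder of [Y] misses the image of [X],
    and on this cylinder [c] may be changed at will.  Pass to a higher block
    presentation in which [c] depends on one edge and some edge [e0] occurs only
    in the cylinder ([higher_block]), and choose the value of [c] at [e0] so that
    a loop through [e0] permutes the sheets cyclically.  The covering graph is
    then strongly connected ([skew_irreducible]), and a strongly connected graph
    has an irreducible edge shift ([connected_irreducible]).

    Finally the skew product is recoded over a larger alphabet so that the
    embedded copy of [X] becomes literally [X] ([embedding_as_inclusion]). *)

Set Implicit Arguments.
Unset Strict Implicit.
Unset Printing Implicit Defensive.

Import Order.TTheory GRing.Theory Num.Theory.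
Import numFieldNormedType.Exports.

Local Open Scope classical_set_scope.
Local Open Scope card_scope.
Local Open Scope ring_scope.

(** * Central windows and compactness *)

Definition agree (A : finType) (N : nat) (x x' : fullshift A) : Prop :=
  forall i : int, (`|i| <= N)%N -> x i = x' i.

Lemma agree_refl (A : finType) N (x : fullshift A) : agree N x x.
Proof. by []. Qed.

Lemma agree_sym (A : finType) N (x y : fullshift A) : agree N x y -> agree N y x.
Proof. by move=> h i iN; rewrite h. Qed.

Lemma agree_trans (A : finType) N (y x z : fullshift A) :
  agree N x y -> agree N y z -> agree N x z.
Proof. by move=> h h' i iN; rewrite h ?h'. Qed.

Lemma agreeW (A : finType) N M (x y : fullshift A) :
  (N <= M)%N -> agree M x y -> agree N x y.
Proof. by move=> NM h i iN; apply: h; exact: leq_trans NM. Qed.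

Lemma agree_eq (A : finType) (x y : fullshift A) :
  (forall N, agree N x y) -> x = y.
Proof. by move=> h; apply/funext => i; apply: (h `|i|%N). Qed.

(** All topological conditions are handled through this basis of neighbourhoods,
    the cylinders on central windows. *)
Lemma nbhs_agree (A : finType) (x : fullshift A) (U : set (fullshift A)) :
  nbhs x U <-> exists N, agree N x `<=` U.
Proof.
split; last first.
  move=> [N NU]; apply: filterS NU _.
  have proj1 (i : int) : nbhs x [set y : fullshift A | x i = y i].
    have hx : nbhs (proj i x) [set proj i x].
      exact: (@discrete_set1 (discrete_topology A)).
    have h : nbhs x [set y : fullshift A | proj i y = proj i x].
      exact: (@proj_continuous int (fun _ => discrete_topology A) i x _ hx).
    by apply: (filterS _ h) => y /= yi; exact/esym.
  have all_proj n : nbhs x [set y : fullshift A |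
      forall i : int, (`|i| <= n)%N -> x i = y i].
    elim: n => [|n IH].
      apply: filterS (proj1 0) => y /= y0 i i0.
      by rewrite (_ : i = 0) //; lia.
    apply: filterS (filterI IH (filterI (proj1 n.+1%:Z) (proj1 (- n.+1%:Z)))).
    move=> y /= [h [h1 h2]] i ile.
    have [/h //|lti] := leqP `|i| n.
    have [-> //|-> //] : i = n.+1%:Z \/ i = - n.+1%:Z by lia.
  exact: all_proj.
pose F := filter_from [set: nat] (fun N => agree N x).
have FF : Filter F.
  apply: filter_from_filter; first by exists 0%N.
  move=> i j _ _; exists (maxn i j) => // y xy.
  by split; apply: agreeW xy; rewrite ?leq_maxl ?leq_maxr.
have cF : F --> x.
  apply/cvg_sup => i U' [V] [[W] oW <-] WfN WU.
  apply: (filterS WU); rewrite nbhs_simpl; exists `|i|%N => // y xy /=.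
  by rewrite -(xy i).
by move=> /cF [N _ NU]; exists N.
Qed.

Lemma closed_agree (A : finType) (X : set (fullshift A)) :
  closed X <->
  forall x, (forall N, exists2 y, X y & agree N x y) -> X x.
Proof.
split=> [clX x h|h x clx].
  by apply: clX => U /nbhs_agree[N NU]; have [y Xy xy] := h N; exists y; split=> //; exact: NU.
apply: h => N; have [|y [Xy xy]] := clx (agree N x).
  by apply/nbhs_agree; exists N.
by exists y.
Qed.

(** Sequential compactness, from Tychonoff's theorem. *)
Lemma cluster_seq (A : finType) (u : nat -> fullshift A) :
  exists x, forall N M, exists2 n, (M <= n)%N & agree N x (u n).
Proof.
have cA : compact [set: discrete_topology A] by apply: finite_compact; exact: finite_finset.
have cT := @tychonoff int (fun _ => discrete_topology A) (fun _ => setT) (fun _ => cA).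
have [|x [_ clx]] := cT (u @ \oo) _; first by apply: filterS filterT.
exists x => N M.
have [||y [[n /= Mn <-] xy]] := clx [set u n | n in [set n | (M <= n)%N]] (agree N x).
- by exists M => // n /= Mn; exists n.
- by apply/nbhs_agree; exists N.
- by exists n.
Qed.

(** Two sequences at once, through the full shift on pairs of symbols. *)
Lemma cluster_seq2 (A B : finType) (u : nat -> fullshift A) (v : nat -> fullshift B) :
  exists x y, forall N M, exists2 n, (M <= n)%N & agree N x (u n) /\ agree N y (v n).
Proof.
have [z hz] := cluster_seq (fun n => (fun i => (u n i, v n i)) : fullshift (A * B)%type).
exists (fun i => (z i).1), (fun i => (z i).2) => N M.
have [n Mn h] := hz N M; exists n => //.
by split=> i /h ->.
Qed.

Lemma within_continuous_agree (A B : finType) (X : set (fullshift A))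
    (f : fullshift A -> fullshift B) :
  {within X, continuous f} <->
  forall x, X x -> forall N, exists M, forall x', X x' -> agree M x x' ->
    agree N (f x) (f x').
Proof.
split.
  move=> /subspace_continuousP h x Xx N.
  have := h x Xx (agree N (f x)).
  rewrite nbhs_simpl /= => /(_ _)/nbhs_agree[]; first by apply/nbhs_agree; exists N.
  by move=> M hM; exists M => x' Xx' xx'; apply: (hM x').
move=> h; apply/subspace_continuousP => x Xx U /nbhs_agree[N NU].
have [M hM] := h x Xx N; rewrite nbhs_simpl /=; apply/nbhs_agree; exists M.
by move=> x' xx' Xx'; apply: NU; exact: hM.
Qed.

(** The form in which compactness is used throughout: nested closed conditions
    on pairs of points, each of which can be met, can be met simultaneously. *)
Lemma compact_pair (A B : finType) (X : set (fullshift A)) (Y : set (fullshift B))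
    (P : nat -> fullshift A -> fullshift B -> Prop) :
  closed X -> closed Y ->
  (forall M N x y, (M <= N)%N -> P N x y -> P M x y) ->
  (forall M x y, X x -> Y y ->
    (forall N, exists x' y', [/\ X x', Y y', agree N x x', agree N y y' & P M x' y']) ->
    P M x y) ->
  (forall M, exists x y, [/\ X x, Y y & P M x y]) ->
  exists x y, [/\ X x, Y y & forall M, P M x y].
Proof.
move=> /closed_agree cX /closed_agree cY antiP clP exP.
have /choice[u hu] : forall M, exists p : fullshift A * fullshift B,
    [/\ X p.1, Y p.2 & P M p.1 p.2].
  by move=> M; have [x [y h]] := exP M; exists (x, y).
have [x [y hxy]] := cluster_seq2 (fun n => (u n).1) (fun n => (u n).2).
have Xx : X x.
  apply: cX => N; have [n _ [h _]] := hxy N 0%N; exists (u n).1 => //.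
  by have [] := hu n.
have Yy : Y y.
  apply: cY => N; have [n _ [_ h]] := hxy N 0%N; exists (u n).2 => //.
  by have [] := hu n.
exists x, y; split => // M; apply: clP => // N.
have [n Mn [h h']] := hxy N M; exists (u n).1, (u n).2.
by have [? ? Pn] := hu n; split => //; exact: antiP Pn.
Qed.

(** * Shifts and sliding block codes *)

Definition sh (A : finType) (j : int) (x : fullshift A) : fullshift A :=
  fun i => x (i + j).

Lemma sh0 (A : finType) (x : fullshift A) : sh 0 x = x.
Proof. by apply/funext => i; rewrite /sh addr0. Qed.

Lemma shD (A : finType) (x : fullshift A) j k : sh j (sh k x) = sh (j + k) x.
Proof. by apply/funext => i; rewrite /sh addrA. Qed.

Lemma shift_mapE (A : finType) (x : fullshift A) : shift_map x = sh 1 x.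
Proof. by []. Qed.

Lemma iter_shift_map (A : finType) n (x : fullshift A) :
  iter n (@shift_map A) x = sh n%:Z x.
Proof.
elim: n => [|n IH] /=; first by rewrite sh0.
by rewrite IH shift_mapE shD; congr sh; lia.
Qed.

Lemma agree_sh (A : finType) N M i (x x' : fullshift A) :
  agree (N + M) x x' -> (`|i| <= N)%N -> agree M (sh i x) (sh i x').
Proof. by move=> h iN j jM; apply: h; lia. Qed.

Lemma subshift_sh (A : finType) (X : set (fullshift A)) j x :
  subshift X -> X x -> X (sh j x).
Proof.
move=> [_ eX].
have X1 y : X y -> X (sh 1 y) by move=> Xy; rewrite -eX; exists y.
have XN1 y : X y -> X (sh (-1) y).
  rewrite -{1}eX => -[z Xz <-]; rewrite shift_mapE shD.
  by rewrite (_ : -1 + 1 = 0) ?sh0 //; lia.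
elim: j x => [x|n IH x Xx|n IH x Xx]; first by rewrite sh0.
  by rewrite (_ : n.+1%:Z = 1 + n%:Z) -?shD; [apply/X1/IH | lia].
by rewrite (_ : - n.+1%:Z = -1 - n%:Z) -?shD; [apply/XN1/IH | lia].
Qed.

Lemma subshiftP (A : finType) (X : set (fullshift A)) :
  closed X -> (forall j x, X x -> X (sh j x)) -> subshift X.
Proof.
move=> cX hX; split => //; apply/seteqP; split => [_ [x Xx <-]|x Xx].
  exact: hX.
exists (sh (-1) x); first exact: hX.
by rewrite shift_mapE shD (_ : 1 + -1 = 0) ?sh0.
Qed.

(** Local constancy; the codomain [T] is thought of as discrete. *)
Definition locally_constant (A : finType) (T : Type) (X : set (fullshift A))
    (g : fullshift A -> T) : Prop :=
  forall x, X x -> exists N, forall x', X x' -> agree N x x' -> g x = g x'.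

(** The Lebesgue number argument: a locally constant function on a compact set
    reads a window of bounded size. *)
Lemma locally_constant_uniform (A : finType) (T : Type) (X : set (fullshift A))
    (g : fullshift A -> T) :
  closed X -> locally_constant X g ->
  exists N, forall x x', X x -> X x' -> agree N x x' -> g x = g x'.
Proof.
move=> cX lg; apply: contrapT => h.
have [|||x [x' [Xx Xx' hx]]] :=
    @compact_pair _ _ X X (fun M x x' => agree M x x' /\ g x <> g x') cX cX.
- by move=> M N x x' MN [ag ?]; split => //; exact: agreeW ag.
- move=> M x x' Xx Xx' hx.
  have [N1 h1] := lg x Xx; have [N2 h2] := lg x' Xx'.
  have [y [y' [Xy Xy' xy xy' [yy' gy]]]] := hx (maxn M (maxn N1 N2)).
  split.
    have My : agree M x y by apply: agreeW xy; lia.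
    have My' : agree M x' y' by apply: agreeW xy'; lia.
    exact: agree_trans My (agree_trans yy' (agree_sym My')).
  rewrite (h1 y) //; last by apply: agreeW xy; lia.
  by rewrite (h2 y') //; apply: agreeW xy'; lia.
- move=> M; apply: contrapT => hM; apply: h; exists M => x x' Xx Xx' ag.
  by apply: contrapT => ?; apply: hM; exists x, x'.
have e : x = x' by apply: agree_eq => N; have [] := hx N.
by have [_] := hx 0%N; rewrite e.
Qed.

Section Codes.
Variables (A B : finType) (X : set (fullshift A)) (Y : set (fullshift B)).
Variable f : fullshift A -> fullshift B.
Hypothesis sX : subshift X.

(** The Curtis-Hedlund-Lyndon theorem: commuting with the shift, a code is
    determined by its symbol at [0], which reads a bounded window. *)
Lemma is_codeP : (forall x, X x -> Y (f x)) ->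
  locally_constant X (fun x => f x 0) ->
  (forall j x, X x -> f (sh j x) = sh j (f x)) -> is_code X Y f.
Proof.
move=> fY lf fsh; split => //; last by move=> x Xx; exact: fsh.
have [M hM] := locally_constant_uniform sX.1 lf.
apply/within_continuous_agree => x Xx N; exists (N + M)%N => x' Xx' ag i iN.
have := hM (sh i x) (sh i x') (subshift_sh _ sX Xx) (subshift_sh _ sX Xx')
  (agree_sh ag iN).
by rewrite !fsh // /sh add0r.
Qed.

Hypothesis cf : is_code X Y f.

Lemma code_in x : X x -> Y (f x).
Proof. by case: cf => h _ _; exact: h. Qed.

Lemma code_sh j x : X x -> f (sh j x) = sh j (f x).
Proof.
have f1 y : X y -> f (sh 1 y) = sh 1 (f y) by case: cf => _ _; exact.
have fN1 y : X y -> f (sh (-1) y) = sh (-1) (f y).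
  move=> Xy; have /f1 : X (sh (-1) y) by exact: subshift_sh.
  rewrite shD (_ : 1 + -1 = 0) // sh0 => ->.
  by rewrite shD (_ : -1 + 1 = 0) ?sh0.
elim: j x => [x|n IH x Xx|n IH x Xx]; first by rewrite !sh0.
  rewrite (_ : n.+1%:Z = 1 + n%:Z) -?shD; last by lia.
  by rewrite f1 ?IH ?shD //; exact: subshift_sh.
rewrite (_ : - n.+1%:Z = -1 - n%:Z) -?shD; last by lia.
by rewrite fN1 ?IH ?shD //; exact: subshift_sh.
Qed.

Lemma code_window : exists M, forall N x x', X x -> X x' ->
  agree (N + M) x x' -> agree N (f x) (f x').
Proof.
have [M hM] : exists N, forall x x', X x -> X x' -> agree N x x' -> f x 0 = f x' 0.
  apply: locally_constant_uniform sX.1 _ => x Xx.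
  case: cf => _ /within_continuous_agree h _.
  by have [M hM] := h x Xx 0%N; exists M => x' Xx' ag; apply: hM.
exists M => N x x' Xx Xx' ag i iN.
have := hM (sh i x) (sh i x') (subshift_sh _ sX Xx) (subshift_sh _ sX Xx')
  (agree_sh ag iN).
by rewrite !code_sh // /sh add0r.
Qed.

(** On a compact space an injective code has a sliding block inverse. *)
Lemma inj_code_window : {in X &, injective f} ->
  exists M, forall N x x', X x -> X x' -> agree (N + M) (f x) (f x') ->
    agree N x x'.
Proof.
move=> injf.
suff [M hM] : exists M, forall x x', X x -> X x' -> agree M (f x) (f x') -> x 0 = x' 0.
  exists M => N x x' Xx Xx' ag i iN.
  have := hM (sh i x) (sh i x') (subshift_sh _ sX Xx) (subshift_sh _ sX Xx').
  rewrite !code_sh // => /(_ (agree_sh ag iN)).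
  by rewrite /sh add0r.
have [M0 hM0] := code_window.
apply: contrapT => h.
have [|||x [x' [Xx Xx' hx]]] := @compact_pair _ _ X X
    (fun M x x' => agree M (f x) (f x') /\ x 0 <> x' 0) sX.1 sX.1.
- by move=> M N x x' MN [ag ?]; split => //; exact: agreeW ag.
- move=> M x x' Xx Xx' hx.
  have [y [y' [Xy Xy' xy xy' [yy' gy]]]] := hx (M + M0)%N.
  split; last by rewrite xy // xy'.
  have My := hM0 M _ _ Xx Xy xy; have My' := hM0 M _ _ Xx' Xy' xy'.
  exact: agree_trans My (agree_trans yy' (agree_sym My')).
- move=> M; apply: contrapT => hM; apply: h; exists M => x x' Xx Xx' ag.
  by apply: contrapT => ?; apply: hM; exists x, x'.
have e : f x = f x' by apply: agree_eq => N; have [] := hx N.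
have [_] := hx 0%N; rewrite (injf x x') ?inE //.
Qed.

Lemma code_image_subshift : subshift (f @` X).
Proof.
apply: subshiftP; last first.
  by move=> j _ [x Xx <-]; exists (sh j x); [exact: subshift_sh | exact: code_sh].
apply/closed_agree => y hy; have [M0 hM0] := code_window.
have [|||x [_ [Xx _ hx]]] := @compact_pair _ _ X X
    (fun M x _ => agree M y (f x)) sX.1 sX.1.
- by move=> M N x x' MN; exact: agreeW.
- move=> M x x' Xx _ hx; have [z [_ [Xz _ xz _ yz]]] := hx (M + M0)%N.
  exact: agree_trans yz (agree_sym (hM0 M _ _ Xx Xz xz)).
- by move=> M; have [_ [x Xx <-] h] := hy M; exists x, x.
by exists x => //; apply/esym/agree_eq.
Qed.

End Codes.

Lemma code_comp (A B C : finType) (X : set (fullshift A)) (Y : set (fullshift B))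
    (Z : set (fullshift C)) f g : subshift X -> subshift Y ->
  is_code X Y f -> is_code Y Z g -> is_code X Z (g \o f).
Proof.
move=> sX sY cf cg; apply: is_codeP => // [x Xx|x Xx|j x Xx] /=.
- exact/(code_in cg)/(code_in cf).
- have [M1 h1] := code_window sX cf; have [M2 h2] := code_window sY cg.
  exists (M2 + M1)%N => x' Xx' ag.
  by apply: (h2 0%N) => //; [exact: (code_in cf)|exact: (code_in cf)|exact: h1].
- by rewrite (code_sh sX cf) // (code_sh sY cg) //; exact: (code_in cf).
Qed.

Lemma conjugacy_inj (A B : finType) (X : set (fullshift A)) (Y : set (fullshift B)) f :
  conjugacy X Y f -> {in X &, injective f}.
Proof. by case=> _ [_ + _]. Qed.

Lemma conjugacy_surj (A B : finType) (X : set (fullshift A)) (Y : set (fullshift B)) f y :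
  conjugacy X Y f -> Y y -> exists2 x, X x & f x = y.
Proof. by case=> _ [_ _ h] /h. Qed.

(** The base point serves as a default value outside [Y]: without it the
    alphabet of [X] might be empty. *)
Lemma conjugacy_inverse (A B : finType) (X : set (fullshift A))
    (Y : set (fullshift B)) f (x0 : fullshift A) :
  subshift X -> subshift Y -> conjugacy X Y f ->
  exists g, [/\ conjugacy Y X g, forall x, X x -> g (f x) = x &
    forall y, Y y -> f (g y) = y].
Proof.
move=> sX sY cf.
have /choice[g hg] : forall y, exists x, Y y -> X x /\ f x = y.
  move=> y; have [Yy|nY] := pselect (Y y); last by exists x0.
  by have [x Xx <-] := conjugacy_surj cf Yy; exists x.
have gX y : Y y -> X (g y) by move=> /hg[].
have fg y : Y y -> f (g y) = y by move=> /hg[].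
have gf x : X x -> g (f x) = x.
  move=> Xx; have Yf := code_in cf.1 Xx.
  by apply: (conjugacy_inj cf); rewrite ?inE ?fg //; exact: gX.
exists g; split => //; split.
  apply: is_codeP => // [y Yy|j y Yy].
    have [M hM] := inj_code_window sX cf.1 (conjugacy_inj cf).
    exists M => y' Yy' ag; apply: (hM 0%N _ _ (gX _ Yy) (gX _ Yy')) => //.
    by rewrite !fg.
  have Xg := gX _ Yy.
  by rewrite -[in LHS](fg y) // -(code_sh sX cf.1) // gf //; exact: subshift_sh.
split => [y|y y'|x Xx]; first exact: gX.
- by rewrite !inE => Yy Yy' e; rewrite -(fg y) // e fg.
- by exists (f x); [exact: (code_in cf.1)|exact: gf].
Qed.

Lemma irreducible_agree (A : finType) (X : set (fullshift A)) : subshift X ->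
  irreducible X <-> exists2 x, X x &
    forall y N, X y -> exists n, agree N y (sh n%:Z x).
Proof.
move=> sX; split=> -[x Xx hx]; exists x => //.
  move=> y N; rewrite -hx => cly.
  have [|_ [[n _ <-] h]] := cly (agree N y); first by apply/nbhs_agree; exists N.
  by exists n; rewrite -iter_shift_map.
apply/seteqP; split.
  rewrite closureE => y; apply; split; first exact: sX.1.
  by move=> _ [n _ <-]; rewrite iter_shift_map; exact: subshift_sh.
move=> y Xy U /nbhs_agree[N NU]; have [n hn] := hx y N Xy.
by exists (sh n%:Z x); split; [exists n => //; rewrite iter_shift_map|exact: NU].
Qed.

Lemma irreducible_image (A B : finType) (X : set (fullshift A))
    (Y : set (fullshift B)) f : subshift X -> subshift Y ->
  conjugacy X Y f -> irreducible X -> irreducible Y.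
Proof.
move=> sX sY cf /(irreducible_agree sX)[x Xx hx]; apply/(irreducible_agree sY).
have [M hM] := code_window sX cf.1.
exists (f x); first exact: (code_in cf.1).
move=> y N /(conjugacy_surj cf)[z Xz <-].
have [n hn] := hx z (N + M)%N Xz; exists n.
by rewrite -(code_sh sX cf.1) //; apply: hM => //; exact: subshift_sh.
Qed.

(** * Fibres of a bi-closing code *)

Section Fibres.
Variables (A B : finType) (X : set (fullshift A)) (Y : set (fullshift B)).
Variable phi : fullshift A -> fullshift B.
Hypothesis (sX : subshift X) (cphi : is_code X Y phi).

(** Both closing conditions say that points of a fibre that agree on a half-line
    [D] of indices, the union of the [D M], agree at [0]; by compactness a finite
    part [D M] of the half-line already suffices. *)
Lemma closing_window (D : nat -> int -> Prop) :
  (forall M N i, (M <= N)%N -> D M i -> D N i) ->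
  (forall x x', X x -> X x' -> phi x = phi x' ->
    (forall M i, D M i -> x i = x' i) -> x 0 = x' 0) ->
  exists M, forall x x', X x -> X x' -> phi x = phi x' ->
    (forall i, D M i -> x i = x' i) -> x 0 = x' 0.
Proof.
move=> monD hD; apply: contrapT => h; have [M0 hM0] := code_window sX cphi.
have [|||x [x' [Xx Xx' hx]]] := @compact_pair _ _ X X
    (fun M x x' => [/\ phi x = phi x', forall i, D M i -> x i = x' i & x 0 <> x' 0])
    sX.1 sX.1.
- by move=> M N x x' MN [? h1 ?]; split => // i /(monD _ _ _ MN); exact: h1.
- move=> M x x' Xx Xx' hx; split.
  + apply: agree_eq => N.
    have [y [y' [Xy Xy' xy xy' [e _ _]]]] := hx (N + M0)%N.
    have a := hM0 N _ _ Xx Xy xy; have a' := hM0 N _ _ Xx' Xy' xy'.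
    by apply: agree_trans a _; rewrite e; exact: agree_sym.
  + move=> i Di; have [y [y' [Xy Xy' xy xy' [_ e _]]]] := hx `|i|%N.
    by rewrite xy // xy' // e.
  + have [y [y' [Xy Xy' xy xy' [_ _ e]]]] := hx 0%N.
    by rewrite xy // xy'.
- move=> M; apply: contrapT => hM; apply: h; exists M => x x' Xx Xx' e hi.
  by apply: contrapT => ?; apply: hM; exists x, x'.
have [e _ n0] := hx 0%N; apply: n0; apply: hD => // M i Di.
by have [_ + _] := hx M; apply.
Qed.

Hypothesis closing : bi_closing X phi.

(** Agreement on a large central window propagates to the right by
    right-closing and to the left by left-closing. *)
Lemma fiber_separated : exists N, forall x x', X x -> X x' -> phi x = phi x' ->
  agree N x x' -> x = x'.
Proof.
have [N1 h1] : exists M, forall x x', X x -> X x' -> phi x = phi x' ->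
    (forall i : int, - M%:Z <= i < 0 -> x i = x' i) -> x 0 = x' 0.
  apply: (@closing_window (fun M i => - M%:Z <= i < 0)); first by move=> M N i; lia.
  move=> x x' Xx Xx' e h; apply: contrapT => n0.
  have := closing.2 x x' Xx Xx'; apply => //; first by move=> xx'; rewrite xx' in n0.
  by exists (-1) => i i0; apply: (h `|i|%N); lia.
have [N2 h2] : exists M, forall x x', X x -> X x' -> phi x = phi x' ->
    (forall i : int, 0 < i <= M%:Z -> x i = x' i) -> x 0 = x' 0.
  apply: (@closing_window (fun M i => 0 < i <= M%:Z)); first by move=> M N i; lia.
  move=> x x' Xx Xx' e h; apply: contrapT => n0.
  have := closing.1 x x' Xx Xx'; apply => //; first by move=> xx'; rewrite xx' in n0.
  by exists 1 => i i0; apply: (h `|i|%N); lia.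
exists (maxn N1 N2) => x x' Xx Xx' e ag; apply: agree_eq => n.
have {ag} : agree (n + maxn N1 N2) x x'; last by apply: agreeW; lia.
have at0 i : sh i x 0 = sh i x' 0 -> x i = x' i by rewrite /sh add0r.
have eS i : phi (sh i x) = phi (sh i x') by rewrite !(code_sh sX cphi) // e.
have XS i := subshift_sh i sX Xx; have XS' i := subshift_sh i sX Xx'.
elim: n => [//|n IH] i iN.
have [/IH //|ni] := leqP `|i| (n + maxn N1 N2).
have [ip|ip] := leP 0 i.
  by apply/at0/h1 => // j hj; rewrite /sh; apply: IH; lia.
by apply/at0/h2 => // j hj; rewrite /sh; apply: IH; lia.
Qed.

(** Upper semicontinuity of the fibre: otherwise points far from the fibre of
    [y], whose images tend to [y], would accumulate at a point of that fibre. *)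
Lemma fiber_usc y N : exists M, forall x', X x' -> agree M y (phi x') ->
  exists x, fiber X phi y x /\ agree N x x'.
Proof.
apply: contrapT => h; have [M0 hM0] := code_window sX cphi.
have [|||x [_ [Xx _ hx]]] := @compact_pair _ _ X X
    (fun M x' _ => agree M y (phi x') /\
      forall x, fiber X phi y x -> ~ agree N x x') sX.1 sX.1.
- by move=> M M' x x' MN [ag ?]; split => //; exact: agreeW ag.
- move=> M x x' Xx Xx' hx; split.
    have [z [_ [Xz _ xz _ [e _]]]] := hx (M + M0)%N.
    have a := hM0 M _ _ Xx Xz xz.
    by apply: agree_trans e _; exact: agree_sym.
  move=> x1 fx1 ax1; have [z [_ [Xz _ xz _ [_ e]]]] := hx N.
  by apply: (e x1) => //; exact: agree_trans xz.
- move=> M; apply: contrapT => hM; apply: h; exists M => x' Xx' ag.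
  apply: contrapT => hx'; apply: hM; exists x', x'; split => //; split => //.
  by move=> x fx ax; apply: hx'; exists x.
have [_] := hx 0%N; apply; last exact: agree_refl.
by split => //=; apply/esym/agree_eq => M; have [] := hx M.
Qed.

Lemma fiber_card_bounded : exists m, forall y, fiber X phi y #<= `I_m.
Proof.
have [N hN] := fiber_separated.
pose g (x : fullshift A) := [ffun i : 'I_(N + N).+1 => (x (i%:Z - N%:Z) : A)].
have /finite_setP[m hm] : finite_set [set: {ffun 'I_(N + N).+1 -> A}].
  exact: finite_finset.
exists m => y; rewrite -(card_le_eqr hm).
have inj : {in fiber X phi y &, injective g}.
  move=> x x'; rewrite !inE => -[Xx /= ex] [Xx' /= ex'] /ffunP e.
  apply: hN => //; first by rewrite ex ex'.
  move=> i iN; have iN' : (`|(i + N%:Z)%R| < (N + N).+1)%N by lia.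
  have := e (Ordinal iN'); rewrite !ffunE /=.
  by rewrite (_ : `|(i + N%:Z)%R|%N%:Z - N%:Z = i) //; lia.
by rewrite -(card_le_eql (inj_card_eq inj)); apply: subset_card_le.
Qed.

Lemma max_fiber_card_exists : Y !=set0 -> exists d, max_fiber_card X Y phi d.
Proof.
move=> [y0 Yy0]; have [m hm] := fiber_card_bounded.
pose Q d := `[< exists2 y, Y y & fiber X phi y #= `I_d >].
have fin y : exists2 d, fiber X phi y #= `I_d & (d <= m)%N.
  have /finite_setP[d hd] : finite_set (fiber X phi y).
    by apply/finite_set_leP; exists m.
  by exists d => //; rewrite -card_le_II -(card_le_eql hd).
have exQ : exists d, Q d.
  by have [d hd _] := fin y0; exists d; apply/asboolP; exists y0.
have ubQ d : Q d -> (d <= m)%N.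
  by move=> /asboolP[y _ hd]; rewrite -card_le_II -(card_le_eql hd).
have [d /asboolP Qd maxd] := ex_maxnP exQ ubQ.
exists d; split => // y Yy; have [e he _] := fin y.
by rewrite (card_le_eql he) card_le_II; apply: maxd; apply/asboolP; exists y.
Qed.

End Fibres.

(** A clopen partition subordinate to a cover by cylinders: [r y] is the centre
    of a cylinder, of radius prescribed by [M], containing [y]. *)
Lemma cylinder_selection (B : finType) (Y : set (fullshift B))
    (M : fullshift B -> nat) : closed Y -> Y !=set0 ->
  exists N r, (forall y y', agree N y y' -> r y = r y') /\
    forall y, Y y -> Y (r y) /\ agree (M (r y)) (r y) y.
Proof.
move=> cY [b Yb].
have [N hN] : exists N, forall y, Y y ->
    exists y0, [/\ Y y0, (M y0 <= N)%N & agree (M y0) y0 y].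
  apply: contrapT => h.
  have [|||y [y' [Yy _ hy]]] := @compact_pair _ _ Y Y
    (fun N y _ => forall y0, Y y0 -> (M y0 <= N)%N -> ~ agree (M y0) y0 y) cY cY.
  - by move=> N N' y _ NN' hy y0 Yy0 le; apply: hy => //; exact: leq_trans NN'.
  - move=> N y y' Yy _ hy y0 Yy0 le ag.
    have [z [_ [_ _ yz _ hz]]] := hy (M y0); apply: (hz y0) => //.
    exact: agree_trans yz.
  - move=> N; apply: contrapT => hN; apply: h; exists N => y Yy.
    apply: contrapT => hy; apply: hN; exists y, y; split => // y0 Yy0 le ag.
    by apply: hy; exists y0.
  by apply: (hy (M y) y) => //; exact: agree_refl.
pose S y := [set y0 | [/\ Y y0, (M y0 <= N)%N & agree (M y0) y0 y]].
exists N, (fun y => xget b (S y)); split.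
  move=> y y' ag; congr xget; apply/seteqP; split=> z [Yz le az]; split => //.
    exact: agree_trans az (agreeW le ag).
  exact: agree_trans az (agreeW le (agree_sym ag)).
by move=> y Yy; have [z Sz] := hN y Yy; case: (@xgetPex _ b (S y) (ex_intro (S y) z Sz)).
Qed.

(** One transposition per new point [a] corrects the value at [a] without
    touching the values already prescribed. *)
Lemma extend_to_perm (T : finType) (s : seq T) (f : T -> T) : uniq s ->
  {in s &, injective f} -> exists p : {perm T}, {in s, forall t, p t = f t}.
Proof.
elim: s => [|a s IH] /=; first by exists 1%g.
move=> /andP[as_ us] injf.
have [|p hp] := IH us; first by move=> x y xs ys; apply: injf; rewrite inE ?xs ?ys orbT.
exists (p * tperm (p a) (f a))%g => t; rewrite permM inE => /predU1P[->|ts].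
  by rewrite tpermL.
rewrite (hp t) // tpermD //.
  by rewrite -(hp t) // (inj_eq perm_inj); apply: contraNneq as_ => ->.
apply: contraNneq as_ => /injf -> //; rewrite inE ?eqxx ?ts ?orbT //.
Qed.

Section Labelling.
Variables (A B : finType) (X : set (fullshift A)) (Y : set (fullshift B)).
Variable phi : fullshift A -> fullshift B.
Hypothesis (sX : subshift X) (sY : subshift Y) (Y0 : Y !=set0).
Hypothesis (cphi : is_code X Y phi) (closing : bi_closing X phi).

(** Near a point [y], every fibre injects into the fibre of [y] by sending a
    point to its unique close neighbour, so a numbering of the fibre of [y]
    numbers all nearby fibres continuously; clopen pieces of this kind cover
    [Y]. *)
Lemma fiber_labelling n : (forall y, Y y -> fiber X phi y #<= `I_n.+1) ->
  exists k : fullshift A -> 'I_n.+1, locally_constant X k /\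
    forall x x', X x -> X x' -> phi x = phi x' -> k x = k x' -> x = x'.
Proof.
move=> hn; have [N0 sep] := fiber_separated sX cphi closing.
have /choice[M hM] := fun y => @fiber_usc _ _ _ _ _ sX cphi y N0.
have [N [r [rN rY]]] := cylinder_selection M sY.1 Y0.
have /choice[l hl] : forall y, exists l : fullshift A -> 'I_n.+1,
    Y y -> {in fiber X phi y &, injective l}.
  move=> y; have [Yy|nY] := pselect (Y y); last by exists (fun=> ord0).
  have /pcard_leP/injfunPex[g gI gi] := hn y Yy.
  exists (fun x => inord (g x)) => _ x x' fx fx' e; apply: gi => //.
  have /= gx := gI _ (set_mem fx); have /= gx' := gI _ (set_mem fx').
  by move: e => /(congr1 val) /=; rewrite !inordK.
(* [m x] is the neighbour of [x] in the fibre of the centre of its cylinder *)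
have /choice[m hm] : forall x, exists x0, X x ->
    fiber X phi (r (phi x)) x0 /\ agree N0 x0 x.
  move=> x; have [Xx|nX] := pselect (X x); last by exists x.
  have [Yr ar] := rY _ (code_in cphi Xx); have [x0 [f0 a0]] := hM _ _ Xx ar.
  by exists x0.
exists (fun x => l (r (phi x)) (m x)); split.
  move=> x Xx; have [M0 hM0] := code_window sX cphi.
  exists (maxn N0 (N + M0)) => x' Xx' ag.
  have er : r (phi x) = r (phi x').
    by apply/rN/hM0 => //; apply: agreeW ag; lia.
  have [[Xm /= em] am] := hm x Xx; have [[Xm' /= em'] am'] := hm x' Xx'.
  rewrite -er in em' *; congr l; apply: sep => //; first by rewrite em em'.
  apply: agree_trans am _; apply: agree_trans (agree_sym am').
  by apply: agreeW ag; lia.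
move=> x x' Xx Xx' e; rewrite -e => h.
have Yr := (rY _ (code_in cphi Xx)).1.
have [fm am] := hm x Xx; have [fm' am'] := hm x' Xx'; rewrite -e in fm'.
have em : m x = m x' by apply: (hl _ Yr _ _ _ _ h); rewrite inE.
by apply: sep => //; apply: agree_trans (agree_sym am) _; rewrite em.
Qed.

(** The shift moves the labels in the fibre of [y] by a partial injection,
    which upper semicontinuity shows to be a restriction of the one at any
    nearby centre; completing it to a permutation at each centre is enough. *)
Lemma label_cocycle n (k : fullshift A -> 'I_n.+1) : locally_constant X k ->
  (forall x x', X x -> X x' -> phi x = phi x' -> k x = k x' -> x = x') ->
  exists c : fullshift B -> {perm 'I_n.+1}, locally_constant Y c /\
    forall x, X x -> c (phi x) (k x) = k (sh 1 x).
Proof.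
move=> lk injk; have [N0 hN0] := locally_constant_uniform sX.1 lk.
(* radius [1 + N0], since the labels of both [x] and [sh 1 x] must be seen *)
have /choice[M hM] := fun y => @fiber_usc _ _ _ _ _ sX cphi y (1 + N0)%N.
have [N [r [rN rY]]] := cylinder_selection M sY.1 Y0.
have /choice[p hp] : forall y, exists p : {perm 'I_n.+1},
    forall x, fiber X phi y x -> p (k x) = k (sh 1 x).
  move=> y; pose D := [set t | `[< exists2 x, fiber X phi y x & k x = t >]]%SET.
  have /choice[x hx] : forall t, exists x : option (fullshift A), t \in D ->
      exists2 x', x = Some x' & fiber X phi y x' /\ k x' = t.
    move=> t; have [|nD] := boolP (t \in D); last by exists None.
    by rewrite inE => /asboolP[x' fx' kx']; exists (Some x') => _; exists x'.
  pose f t := if x t is Some x' then k (sh 1 x') else t.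
  have [||p hp] := @extend_to_perm _ (enum D) f; first exact: enum_uniq.
    move=> t t'; rewrite !mem_enum /f => /hx[z -> [[Xz /= ez] <-]].
    move=> /hx[z' -> [[Xz' /= ez'] <-]] e; congr k.
    have : sh 1 z = sh 1 z'.
      apply: injk => //; try exact: subshift_sh.
      by rewrite !(code_sh sX cphi) // ez ez'.
    by move=> /(congr1 (sh (-1))); rewrite !shD (_ : -1 + 1 = 0) ?sh0 //; lia.
  exists p => z fz; have kD : k z \in D by rewrite inE; apply/asboolP; exists z.
  rewrite hp ?mem_enum // /f; have [z' -> [fz' kz']] := hx _ kD.
  by rewrite (injk z' z) //; [case: fz'|case: fz|rewrite fz'.2 fz.2].
exists (fun y => p (r y)); split.
  by move=> y _; exists N => y' _ /rN ->.
move=> x Xx; have [Yr ar] := rY _ (code_in cphi Xx).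
have [x0 [f0 a0]] := hM _ _ Xx ar.
have X0 : X x0 by case: f0.
rewrite -(hN0 x0 x) //; last by apply: agreeW a0; lia.
rewrite hp //; apply: hN0; try exact: subshift_sh.
exact: (agree_sh a0).
Qed.

End Labelling.

(** * Edge shifts *)

Lemma edge_shift_subshift (G : digraph) : subshift (edge_shift G).
Proof.
apply: subshiftP => [|j x h i]; last first.
  by rewrite /sh h; congr (initial (x _)); lia.
apply/closed_agree => x hx i; have [y hy xy] := hx (`|i| + 1)%N.
by rewrite !xy ?hy //; lia.
Qed.

(** A function [g] reading a window of [Y] becomes a function of a single edge
    when edges are long blocks of the given presentation and overlapping blocks
    are consecutive. Only blocks that occur are edges, so that every edge lies
    on a bi-infinite path. *)
Lemma higher_block (B : finType) (F : Type) (Y : set (fullshift B))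
    (g : fullshift B -> F) : shift_of_finite_type Y -> Y !=set0 ->
  locally_constant Y g ->
  exists (G : digraph) (h : fullshift B -> fullshift (edge G)) (g' : edge G -> F),
    [/\ conjugacy Y (edge_shift G) h, forall y, Y y -> g y = g' (h y 0) &
      forall e : edge G, exists2 y, Y y & h y 0 = e].
Proof.
move=> [sY [G0 [h0 ch0]]] [b Yb] lg.
have [N hN] := locally_constant_uniform sY.1 lg.
have [M hM] := inj_code_window sY ch0.1 (conjugacy_inj ch0).
(* [g y] depends on the coordinates of [h0 y] from [-K] to [K]; the blocks, of
   length [L.+1], carry one coordinate more, so that each of them witnesses that
   its consecutive symbols are composable edges of [G0]. *)
pose K := (N + M)%N; pose L := (K + K).+1.
pose win (y : fullshift B) : {ffun 'I_L.+1 -> edge G0} :=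
  [ffun j : 'I_L.+1 => (h0 y (j%:Z - K%:Z) : edge G0)].
pose E : Type := {w : {ffun 'I_L.+1 -> edge G0} | `[< exists2 y, Y y & win y = w >]}.
pose G := @Digraph {ffun 'I_L -> edge G0} E
  (fun w => [ffun j : 'I_L => val w (inord j)])
  (fun w => [ffun j : 'I_L => val w (inord j.+1)]).
have winE y : Y y -> `[< exists2 y', Y y' & win y' = win y >].
  by move=> Yy; apply/asboolP; exists y.
pose e0 : E := exist _ (win b) (winE b Yb).
pose h (y : fullshift B) : fullshift (edge G) := fun i => insubd e0 (win (sh i y)) : E.
have hE y i : Y y -> val (h y i : E) = win (sh i y).
  by move=> Yy; rewrite /h val_insubd winE //; exact: subshift_sh.
have hj y i (j : nat) : Y y -> (j < L.+1)%N ->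
    val (h y i : E) (inord j) = h0 y (i + j%:Z - K%:Z).
  move=> Yy jL; rewrite hE // ffunE inordK // (code_sh sY ch0.1) //.
  by rewrite /sh; congr (h0 y _); lia.
have h_inj : forall y y', Y y -> Y y' -> h y = h y' -> y = y'.
  move=> y y' Yy Yy' e; apply: (conjugacy_inj ch0); rewrite ?inE //.
  apply/funext => i; have KL : (K < L.+1)%N by lia.
  have := hj y i K Yy KL; rewrite e hj //.
  by rewrite (_ : i + K%:Z - K%:Z = i) // ; lia.
have h_code : is_code Y (edge_shift G) h.
  apply: is_codeP => // [y Yy i|y Yy|j y Yy].
  - apply/ffunP => j; rewrite !ffunE !hj //; try by case: j => j /= ; lia.
    by congr (h0 y _); lia.
  - have [M0 hM0] := code_window sY ch0.1; exists (L + M0)%N => y' Yy' ag.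
    apply: val_inj; rewrite !hE // !sh0; apply/ffunP => j; rewrite !ffunE.
    by apply: (hM0 L) => //; case: j => j /=; lia.
  - apply/funext => i; apply: val_inj; rewrite hE; last exact: subshift_sh.
    by rewrite shD -hE.
have /choice[r hr] : forall e : E, exists y, Y y /\ win y = val e.
  by move=> e; have /asboolP[y Yy ey] := valP e; exists y.
exists G, h, (fun e => g (r e)); split.
- split => //; split => [y Yy|y y'|e he]; first exact: (code_in h_code).
    by rewrite !inE; exact: h_inj.
  pose a i : edge G0 := val (e i : E) (inord 0).
  have ea i (j : nat) : (j < L.+1)%N -> val (e i : E) (inord j) = a (i + j%:Z).
    elim: j i => [|j IH] i jL; first by rewrite addr0.
    have jL' : (j < L)%N by lia.
    have := he i => /ffunP/(_ (Ordinal jL')); rewrite !ffunE /= => ->.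
    by rewrite IH; [congr (a _); lia | lia].
  pose z : fullshift (edge G0) := fun i => a (i + K%:Z).
  have Gz : edge_shift G0 z.
    move=> i; have [Yr er] := hr (e (i + K%:Z)).
    have a0 j : (j < L.+1)%N ->
        h0 (r (e (i + K%:Z))) (j%:Z - K%:Z) = a (i + K%:Z + j%:Z).
      by move=> jL; rewrite -ea // -er ffunE inordK.
    have := code_in ch0.1 Yr (0%N%:Z - K%:Z).
    rewrite (_ : 0%N%:Z - K%:Z + 1 = 1%N%:Z - K%:Z); last by lia.
    rewrite !a0 // /z => e1.
    rewrite (_ : i + K%:Z = i + K%:Z + 0%N%:Z) ?e1; last by lia.
    by congr (initial (a _)); lia.
  have [y Yy hy] := conjugacy_surj ch0 Gz; exists y => //.
  apply/funext => i; apply: val_inj; apply/ffunP => j.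
  have := hj y i j Yy (ltn_ord j); have := ea i j (ltn_ord j).
  by rewrite inord_val => -> ->; rewrite hy /z; congr (a _); lia.
- move=> y Yy; have [Yr er] := hr (h y 0); apply: hN => //.
  apply: (hM N) => // i iK.
  have : forall j, win (r (h y 0)) j = val (h y 0 : E) j by move=> j; rewrite er.
  have jL : (`|(i + K%:Z)%R| < L.+1)%N by rewrite /L; lia.
  move=> /(_ (Ordinal jL)); rewrite hE // sh0 !ffunE /= => e.
  by rewrite (_ : i = `|(i + K%:Z)%R|%N%:Z - K%:Z) //; lia.
- move=> e; have [Yr er] := hr e; exists (r e) => //.
  by apply: val_inj; rewrite hE // sh0.
Qed.

Definition adj (G : digraph) : rel (edge G) :=
  fun e e' => terminal e == initial e'.

(** A dense forward orbit is obtained by concatenating all finite paths, which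
    strong connectedness allows; going backwards, any predecessors will do. *)
Lemma connected_irreducible (G : digraph) (e0 : edge G) :
  (forall e e' : edge G, connect (@adj G) e e') ->
  (forall e : edge G, exists e', adj e' e) ->
  (forall e : edge G, exists e', adj e e') ->
  irreducible (edge_shift G).
Proof.
move=> conn /choice[p hp] /choice[q hq].
have /choice[ext hext] : forall eu : edge G * seq (edge G), exists w,
    [/\ path (@adj G) eu.1 w, w <> [::] &
        sorted (@adj G) eu.2 -> exists w1, w = w1 ++ eu.2].
  move=> [e [|a u]] /=.
    by exists [:: q e]; split=> //=; [rewrite hq|exists [:: q e]].
  have /connectP[w1 pw1 ew1] := conn (q e) a.
  have [hu|nu] := boolP (path (@adj G) a u); last first.
    by exists [:: q e]; split=> //=; rewrite hq.
  exists ((q e :: w1) ++ u); split => //=.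
    by rewrite hq cat_path pw1 -ew1.
  move=> _; exists (belast (q e) w1).
  by rewrite -cat_cons lastI -ew1 cat_rcons.
pose word j : seq (edge G) := odflt [::] (unpickle j).
pose fix D j := if j is j'.+1 then D j' ++ ext (last e0 (D j'), word j')
                else [:: e0].
have DS j : D j.+1 = D j ++ ext (last e0 (D j), word j) by [].
have sizeD j : (j < size (D j))%N.
  elim: j => // j IH; rewrite DS size_cat.
  have [_ + _] := hext (last e0 (D j), word j).
  by case: (ext _) => //= *; lia.
have sortD j : sorted (@adj G) (D j).
  elim: j => // j IH; rewrite DS.
  have [pe _ _] := hext (last e0 (D j), word j).
  by move: IH pe (sizeD j); case: (D j) => //= d s ps pe _; rewrite cat_path ps.
have leD j k : (size (D j) <= size (D (j + k)%N))%N.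
  elim: k => [|k IH]; first by rewrite addn0.
  by rewrite addnS DS size_cat; apply: leq_trans IH (leq_addr _ _).
have nthD i j k : (i < size (D j))%N -> nth e0 (D (j + k)%N) i = nth e0 (D j) i.
  move=> ij; elim: k => [|k IH]; first by rewrite addn0.
  by rewrite addnS DS nth_cat (leq_trans ij).
pose s i := nth e0 (D i) i.
have sE i j : (i < size (D j))%N -> nth e0 (D j) i = s i.
  move=> ij; have [le|/ltnW le] := leqP i j.
    by rewrite /s -[in RHS](nthD i i (j - i)%N) // subnKC.
  by rewrite /s -(nthD i j (i - j)%N) // subnKC.
have sadj i : adj (s i) (s i.+1).
  have lt := sizeD i.+1; have lt' : (i < size (D i.+1))%N by lia.
  by rewrite -(sE _ _ lt) -(sE _ _ lt'); apply/sortedP.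
pose x : fullshift (edge G) := fun i => match i with
  | Posz n => s n | Negz n => iter n.+1 p e0 end.
have xG : edge_shift G x.
  case=> n; first by rewrite (_ : Posz n + 1 = Posz n.+1) /=; [apply/eqP; exact: sadj|lia].
  case: n => [|n]; first by apply/eqP; exact: hp.
  by rewrite (_ : Negz n.+1 + 1 = Negz n); [apply/eqP; exact: hp|lia].
apply/(irreducible_agree (edge_shift_subshift G)); exists x => // y N yG.
pose u := [seq (y (j%:Z - N%:Z) : edge G) | j <- iota 0 (N + N).+1].
have su : size u = (N + N).+1 by rewrite size_map size_iota.
have nu j : (j < (N + N).+1)%N -> nth e0 u j = y (j%:Z - N%:Z).
  by move=> jN; rewrite (nth_map 0%N) ?size_iota // nth_iota.
have pu : sorted (@adj G) u.
  apply/(sortedP e0) => i; rewrite su => iN; rewrite !nu //; last by lia.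
  apply/eqP; rewrite yG; congr (initial (y _)); lia.
have [_ _ /(_ pu)[w1 ew]] := hext (last e0 (D (pickle u)), u).
have Du : D (pickle u).+1 = D (pickle u) ++ w1 ++ u.
  by rewrite DS /word pickleK /= ew.
pose m := (size (D (pickle u)) + size w1)%N.
exists (m + N)%N => i iN; rewrite /sh.
have [j jE] : exists j : nat, i = j%:Z - N%:Z by exists `|(i + N%:Z)%R|%N; lia.
rewrite jE (_ : j%:Z - N%:Z + (m + N)%:Z = (m + j)%N) /=; last by lia.
have jN : (j < (N + N).+1)%N by lia.
rewrite -nu // -(sE _ (pickle u).+1).
  rewrite Du catA nth_cat size_cat -/m ifF; last by lia.
  by congr nth; lia.
by rewrite Du !size_cat su; lia.
Qed.

(** The preimage under the shift of a point with dense forward orbit is itself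
    approached by that orbit, so the point returns near itself, and hence visits
    every cylinder arbitrarily late. *)
Lemma irreducible_recurrent (A : finType) (X : set (fullshift A)) :
  subshift X -> irreducible X -> exists2 x, X x &
    forall y N K, X y -> exists2 n, (K <= n)%N & agree N y (sh n%:Z x).
Proof.
move=> sX /(irreducible_agree sX)[x Xx hx]; exists x => // y N K Xy.
have rec R : exists2 m, (0 < m)%N & agree R x (sh m%:Z x).
  have [n hn] := hx (sh (-1) x) (1 + R)%N (subshift_sh _ sX Xx).
  exists n.+1 => // ; have := agree_sh hn (i := 1) isT; rewrite !shD.
  by rewrite (_ : 1 + -1 = 0) // sh0 (_ : 1 + n%:Z = n.+1%:Z) //; lia.
elim: K => [|K [n Kn hn]]; first by have [n hn] := hx y N Xy; exists n.
have [m m0 hm] := rec (n + N)%N; exists (n + m)%N; first by lia.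
apply: agree_trans hn _; have := agree_sh hm (i := n%:Z).
rewrite shD (_ : n%:Z + m%:Z = (n + m)%N) //; apply.
by rewrite absz_nat.
Qed.

Lemma irreducible_connected (G : digraph) : irreducible (edge_shift G) ->
  (forall e : edge G, exists2 x, edge_shift G x & x 0 = e) ->
  forall e e' : edge G, connect (@adj G) e e'.
Proof.
move=> /(irreducible_recurrent (edge_shift_subshift G))[x Gx hx] ess e e'.
have [y Gy <-] := ess e; have [y' Gy' <-] := ess e'.
have [n _ /(_ 0 isT) ->] := hx y 0%N 0%N Gy.
have [m nm /(_ 0 isT) ->] := hx y' 0%N n Gy'.
rewrite /sh !add0r -(subnKC nm); elim: (m - n)%N => [|k IH].
  by rewrite addn0 connect0.
apply: connect_trans IH (connect1 _); apply/eqP; rewrite Gx.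
by congr (initial (x _)); lia.
Qed.

(** * Skew products over an edge shift *)

(** The extension of an edge shift by a permutation-valued cocycle is the edge
    shift of the [n.+1]-fold covering graph with these monodromies. *)
Definition skew_graph (G : digraph) n (c : edge G -> {perm 'I_n.+1}) : digraph :=
  @Digraph (vertex G * 'I_n.+1)%type (edge G * 'I_n.+1)%type
    (fun es => (initial es.1, es.2)) (fun es => (terminal es.1, c es.1 es.2)).

Section Skew.
Variables (G : digraph) (n : nat).
Implicit Types c : edge G -> {perm 'I_n.+1}.

Lemma skew_step c (e e' : edge G) s : adj e e' ->
  connect (@adj (skew_graph c)) (e, s) (e', c e s).
Proof. by move=> /eqP ee'; apply: connect1; rewrite /adj /= ee'. Qed.

(** A path lifts from each sheet, ending on a sheet given by the product of the
    cocycle. The last edge does not contribute, which allows the cocycle to be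
    modified afterwards at an edge where the path ends. *)
Lemma skew_lift c (e : edge G) q : path (@adj G) e q ->
  exists p : {perm 'I_n.+1}, forall c', {in belast e q, c' =1 c} ->
    forall s, connect (@adj (skew_graph c')) (e, s) (last e q, p s).
Proof.
elim: q e => [|a q IH] e /=; first by exists 1%g => c' _ s; rewrite perm1.
move=> /andP[ea /IH[p hp]]; exists (c e * p)%g => c' hc s.
have c'e : c' e = c e by apply: hc; rewrite inE eqxx.
rewrite permM -c'e; apply: connect_trans (skew_step c' s ea) _.
by apply: hp => b bq; apply: hc; rewrite inE bq orbT.
Qed.

(** Adjusting the cocycle at a single edge [e0] makes the skew product
    irreducible: follow [e0] by a simple path back to it, and choose the value at
    [e0] so that going once around this loop permutes the sheets cyclically. *)
Lemma skew_irreducible c (e0 : edge G) :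
  (forall e e' : edge G, connect (@adj G) e e') ->
  (forall e : edge G, exists e', adj e' e) ->
  (forall e : edge G, exists e', adj e e') ->
  exists c', (forall e, e != e0 -> c' e = c e) /\
    irreducible (edge_shift (skew_graph c')).
Proof.
move=> conn pre suc; have [e1 e01] := suc e0.
have /connectP[q0 pq0 eq0] := conn e1 e0.
(* on a simple path [e0] is the last edge only, so [p] does not depend on the
   new value at [e0] *)
case/shortenP: pq0 eq0 => q pq uq _ e0q.
have [p hp] := skew_lift c pq.
pose cyc : {perm 'I_n.+1} := perm (@ordS_inj n.+1).
pose c' e := if e == e0 then (cyc * p^-1)%g else c e.
exists c'; split; first by move=> e /negbTE; rewrite /c' => ->.
have loop s : connect (@adj (skew_graph c')) (e0, s) (e0, ordS s).
  have c'q : {in belast e1 q, c' =1 c}.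
    move=> e eq; rewrite /c' ifN //; apply: contraTneq eq => ->.
    by move: uq; rewrite lastI rcons_uniq -e0q => /andP[].
  have := hp c' c'q (c' e0 s); rewrite -e0q.
  rewrite (_ : p (c' e0 s) = ordS s); last by rewrite /c' eqxx permM permKV permE.
  exact: connect_trans (skew_step c' s e01).
have turn s t : connect (@adj (skew_graph c')) (e0, s) (e0, t).
  have iterS m : connect (@adj (skew_graph c')) (e0, s) (e0, iter m (@ordS n.+1) s).
    by elim: m => [|m IH] /=; [exact: connect0|exact: connect_trans IH (loop _)].
  have iterE m : iter m (@ordS n.+1) s = ((s + m) %% n.+1)%N :> nat.
    elim: m => [|m IH] /=; first by rewrite addn0 modn_small.
    by rewrite IH -addn1 modnDml addn1 addnS.
  have := iterS (t + (n.+1 - s))%N; congr connect; congr (_, _).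
  apply: val_inj; rewrite /= iterE (_ : s + _ = t + n.+1)%N.
    by rewrite modnDr modn_small.
  by have := ltn_ord s; lia.
have lift e e' : exists p : {perm 'I_n.+1}, forall s,
    connect (@adj (skew_graph c')) (e, s) (e', p s).
  have /connectP[r pr ->] := conn e e'; have [p' hp'] := skew_lift c' pr.
  by exists p' => s; exact: hp'.
apply: (@connected_irreducible (skew_graph c') (e0, ord0)).
- move=> [e s] [e' s']; have [p1 h1] := lift e e0; have [p2 h2] := lift e0 e'.
  apply: connect_trans (h1 s) _; apply: connect_trans (turn _ (p2^-1 s')%g) _.
  by have := h2 (p2^-1 s')%g; rewrite permKV.
- move=> [e s]; have [e' /eqP ee'] := pre e; exists (e', ((c' e')^-1 s)%g).
  by rewrite /adj /= ee' permKV.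
- by move=> [e s]; have [e' /eqP ee'] := suc e; exists (e', c' e s); rewrite /adj /= ee'.
Qed.

Definition base c (z : fullshift (edge (skew_graph c))) : fullshift (edge G) :=
  fun i => (z i).1.

Lemma base_code c : is_code (edge_shift (skew_graph c)) (edge_shift G) (@base c).
Proof.
apply: is_codeP => //; first exact: edge_shift_subshift.
  by move=> z hz i; have [] := hz i.
by move=> z _; exists 0%N => z' _ /(_ 0 isT); rewrite /base => ->.
Qed.

(** Over a given path, the sheet at [0] determines all the others, since the
    monodromies are invertible. *)
Lemma skew_point_eq c z z' : edge_shift (skew_graph c) z -> edge_shift (skew_graph c) z' ->
  base z = base z' -> (z 0).2 = (z' 0).2 -> z = z'.
Proof.
move=> hz hz' eb e0; have b1 i : (z i).1 = (z' i).1 by move/funeqP: eb; exact.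
suff h i : (z i).2 = (z' i).2.
  by apply/funext => i; rewrite [z i]surjective_pairing b1 h -surjective_pairing.
have stepz j : (z (j + 1)).2 = c (z j).1 (z j).2 by have [] := hz j.
have stepz' j : (z' (j + 1)).2 = c (z' j).1 (z' j).2 by have [] := hz' j.
elim: i => [//|m IH|m IH].
  by rewrite (_ : m.+1%:Z = m%:Z + 1) ?stepz ?stepz' ?IH ?b1 //; lia.
apply: (@perm_inj _ (c (z (- m.+1%:Z)).1)); rewrite {2}b1 -stepz -stepz'.
by rewrite (_ : - m.+1%:Z + 1 = - m%:Z) //; lia.
Qed.

Lemma skew_point_exists c y s : edge_shift G y ->
  exists2 z, edge_shift (skew_graph c) z & base z = y /\ (z 0).2 = s.
Proof.
move=> hy.
pose fix fwd m := if m is m'.+1 then c (y m'%:Z) (fwd m') else s.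
pose fix bwd m := if m is m'.+1 then ((c (y (- m%:Z)))^-1)%g (bwd m') else s.
pose k (i : int) : 'I_n.+1 := match i with Posz m => fwd m | Negz m => bwd m.+1 end.
have kS i : k (i + 1) = c (y i) (k i).
  case: i => m; first by rewrite (_ : Posz m + 1 = Posz m.+1) //; lia.
  case: m => [|m].
    rewrite (_ : Negz 0 + 1 = 0) //= (_ : Negz 0 = -1) //.
    by rewrite permKV.
  rewrite (_ : Negz m.+1 + 1 = Negz m); last by lia.
  by rewrite [k (Negz m.+1)]/= NegzE permKV.
by exists (fun i => (y i, k i)) => // i; rewrite /= kS hy.
Qed.

End Skew.

(** * Realizing an embedding by an inclusion of alphabets *)

(** If the image [u x] determines [f x] through a window of radius [M], then [f]
    is read off by a block map defined on all points; the value [None] stands for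
    windows that do not occur, as [F] may be empty. *)
Lemma block_extension (A C : finType) (F : choiceType) (X : set (fullshift A))
    (u : fullshift A -> fullshift C) (f : fullshift A -> F) M :
  (forall x x', X x -> X x' -> agree M (u x) (u x') -> f x = f x') ->
  exists g : fullshift C -> option F,
    (forall z z', agree M z z' -> g z = g z') /\
    (forall x, X x -> g (u x) = Some (f x)).
Proof.
move=> hf; pose S z := [set o | exists x, [/\ X x, agree M z (u x) & o = Some (f x)]].
exists (fun z => xget None (S z)); split.
  move=> z z' ag; congr xget; apply/seteqP; split=> o [x [Xx ax ->]].
    by exists x; split => //; exact: agree_trans (agree_sym ag) ax.
  by exists x; split => //; exact: agree_trans ag ax.
move=> x Xx; have Sx : S (u x) (Some (f x)) by exists x.
have [x' [Xx' ax' ->]] := @xgetPex _ None (S (u x)) (ex_intro _ _ Sx).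
by congr Some; apply: hf => //; exact: agree_sym.
Qed.

(** A point [z] is encoded by the symbols [g] of the point of [X] that it
    resembles, as long as a block map [b] recovers [z] from them; where [b]
    fails, the symbol of [z] is recorded too. On the image of [X] there is no
    failure, and the encoding is injective since it always retains [g]. *)
Lemma embedding_as_inclusion (A C : finType) (X : set (fullshift A))
    (Z : set (fullshift C)) (psi : fullshift A -> fullshift C) :
  subshift X -> subshift Z -> is_code X Z psi -> {in X &, injective psi} ->
  exists (A' : finType) (iota : A -> A') (X' : set (fullshift A'))
      (theta : fullshift C -> fullshift A'),
    [/\ injective iota, subshift X', conjugacy Z X' theta &
      forall x, X x -> theta (psi x) = (fun i => iota (x i))].
Proof.
move=> sX sZ cpsi injpsi.
have [M1 hM1] := inj_code_window sX cpsi injpsi.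
have [M2 hM2] := code_window sX cpsi.
(* [g] guesses the symbol at [0] of the point of [X] from its image *)
have [|g [gM gE]] := @block_extension A C A X psi (fun x => x 0) M1.
  by move=> x x' Xx Xx' ag; apply: (hM1 0%N).
pose somes (x : fullshift A) : fullshift (option A) := fun i => Some (x i).
have [|b [bM bE]] := @block_extension A (option A) C X somes (fun x => psi x 0) M2.
  move=> x x' Xx Xx' ag; apply: (hM2 0%N) => // i iM.
  by have := ag i iM; rewrite /somes => -[].
pose gs (z : fullshift C) : fullshift (option A) := fun i => g (sh i z).
have gs_sh j z : gs (sh j z) = sh j (gs z).
  by apply/funext => i; rewrite [RHS]/sh /gs shD.
pose A' : finType := (A + option A * C)%type.
pose a (z : fullshift C) : A' :=
  if g z is Some a0 then
    if b (gs z) == Some (z 0) then inl a0 else inr (g z, z 0)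
  else inr (g z, z 0).
pose dec (l : A') := match l with inl a0 => Some a0 | inr p => p.1 end.
have decE z : dec (a z) = g z.
  by rewrite /a; case eg : (g z) => [a0|] //=; case: ifP => //= _; rewrite eg.
pose theta (z : fullshift C) : fullshift A' := fun i => a (sh i z).
have thetaX x : X x -> theta (psi x) = (fun i => inl (x i)).
  move=> Xx; apply/funext => i; rewrite /theta -(code_sh sX cpsi) //.
  have Xi := subshift_sh i sX Xx; rewrite /a gE //.
  rewrite (_ : gs (psi (sh i x)) = somes (sh i x)).
    by rewrite bE // eqxx /sh add0r.
  apply/funext => j; rewrite /gs -(code_sh sX cpsi) // gE; last exact: subshift_sh.
  by rewrite /sh add0r.
have ctheta : is_code Z (theta @` Z) theta.
  apply: is_codeP => // [z Zz|j z Zz].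
    exists (M2 + M1)%N => z' Zz' ag; rewrite /theta !sh0 /a.
    have -> : g z = g z' by apply: gM; apply: agreeW ag; lia.
    have -> : b (gs z) = b (gs z').
      by apply: bM => i iM; apply: gM; exact: agree_sh ag iM.
    by rewrite (ag 0).
  by apply/funext => i; rewrite /theta shD.
have injtheta : {in Z &, injective theta}.
  move=> z z' _ _ e; apply/funext => i.
  have ai j : a (sh j z) = a (sh j z') by move/funeqP: e => /(_ j).
  have gi j : g (sh j z) = g (sh j z') by rewrite -!decE ai.
  have gsE : gs (sh i z) = gs (sh i z').
    by rewrite !gs_sh; apply/funext => j; rewrite /sh /gs gi.
  have := ai i; rewrite /a gi gsE /sh !add0r -/(sh i z').
  case: (g _) => [a0|[]//]; case: eqP => [->|_]; case: eqP => [[]|_] //.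
  by case.
exists A', inl, (theta @` Z), theta; split => //.
- by move=> x x' [].
- exact: (code_image_subshift sZ ctheta).
- by split => //; split.
Qed.

(** * Entropy *)

(** Fekete's lemma: the limit is the infimum of the [u n / n]. If [u m / m] is
    close to it, Euclidean division of [n] by [m] gives
    [u n / n <= u m / m + C / n], where [C] bounds the finitely many [u r] with
    [r < m]. *)
Lemma subadditive_cvg (R : realType) (u : nat -> R) :
  (forall n, 0 <= u n) -> (forall m n, u (m + n)%N <= u m + u n) ->
  cvgn (fun n => u n / n%:R).
Proof.
move=> u0 uD; pose S := [set u n / n%:R | n in [set n | (0 < n)%N]].
have S_inf : has_inf S.
  split; first by exists (u 1%N / 1); exists 1%N.
  by exists 0 => _ [n _ <-]; exact: divr_ge0.
apply/cvg_ex; exists (inf S); apply/cvgrPdist_le => e e0.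
have e2 : 0 < e / 2 by rewrite divr_gt0.
have [_ [m /= m0 <-] hm] := inf_adherent e2 S_inf.
pose C := \sum_(r < m) u r.
have uC r : (r < m)%N -> u r <= C.
  move=> rm; rewrite /C (bigD1 (Ordinal rm)) //= lerDl.
  by apply: sumr_ge0.
have uq q r : u (q * m + r)%N <= q%:R * u m + u r.
  elim: q => [|q IH]; first by rewrite mul0n add0n mul0r add0r.
  rewrite mulSn -addnA; apply: le_trans (uD _ _) _.
  by rewrite -addn1 natrD mulrDl mul1r addrAC [leRHS]addrC lerD2l.
near=> n.
have n0 : (0 < n)%N by near: n; exact: nbhs_infty_gt.
have nR0 : 0 < n%:R :> R by rewrite ltr0n.
have mR0 : 0 < m%:R :> R by rewrite ltr0n.
have Cn : C / n%:R <= e / 2.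
  rewrite ler_pdivrMr // -ler_pdivrMl //; near: n; exact: nbhs_infty_ger.
have infn : inf S <= u n / n%:R by apply: ge_inf; [case: S_inf | exists n].
rewrite ler_distlC; apply/andP; split.
  by apply: le_trans infn; rewrite lerBlDr lerDl ltW.
have q_le : (n %/ m)%:R * u m <= n%:R * (u m / m%:R).
  rewrite [leRHS]mulrCA [leRHS]mulrC ler_wpM2r //.
  by rewrite ler_pdivlMr // -natrM ler_nat leq_trunc_div.
have : u n <= n%:R * (u m / m%:R) + C.
  rewrite {1}(divn_eq n m); apply: le_trans (uq _ _) _.
  by apply: lerD => //; apply: uC; rewrite ltn_mod.
move=> h; have : u n / n%:R <= u m / m%:R + C / n%:R.
  rewrite ler_pdivrMr // mulrDl divfK ?gt_eqF //.
  by rewrite [_ * n%:R]mulrC.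
move=> h'; apply: le_trans h' _.
have := ltW hm; move: Cn; set a := u m / _; set b := C / _ => Cn ha.
rewrite [e]splitr addrA; exact: lerD.
Unshelve. all: by end_near.
Qed.

(** A relation rather than a function from [P] to [Q], as [T'] may be empty. *)
Lemma leq_card_rel (T T' : finType) (P : pred T) (Q : pred T') (r : T -> T' -> Prop) :
  (forall w, P w -> exists2 v, Q v & r w v) ->
  (forall w w' v, r w v -> r w' v -> w = w') -> (#|P| <= #|Q|)%N.
Proof.
move=> ex inj; have [w0 Pw0|P0] := pickP P; last by rewrite eq_card0.
pose g v := odflt w0 [pick w | `[< r w v >]].
apply: leq_trans (leq_image_card g Q); apply/subset_leq_card/fintype.subsetP => w Pw.
have [v Qv rwv] := ex w Pw.
suff -> : w = g v by exact: fintype.image_f.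
rewrite /g; case: pickP => [w' /asboolP h|/(_ w) /asboolP //] /=.
exact: inj rwv h.
Qed.

Lemma nb_blocksE (A : finType) (X : set (fullshift A)) n : subshift X ->
  nb_blocks X n = #|[pred w : n.-tuple A |
    `[< exists2 x, X x & forall k : 'I_n, x k%:Z = tnth w k >] ]|.
Proof.
move=> sX; apply: eq_card => w; apply/asboolP/asboolP => -[x Xx].
  move=> [i hi]; exists (sh i x); first exact: subshift_sh.
  by move=> k; rewrite /sh addrC hi.
by move=> h; exists x => //; exists 0 => k; rewrite add0r h.
Qed.

Lemma nb_blocks_submul (A : finType) (X : set (fullshift A)) m n : subshift X ->
  (nb_blocks X (m + n) <= nb_blocks X m * nb_blocks X n)%N.
Proof.
move=> sX; rewrite !nb_blocksE // -cardX.
apply: (@leq_card_rel _ _ _ _ (fun w v =>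
  (forall k, tnth w (lshift n k) = tnth v.1 k) /\
  (forall k, tnth w (rshift m k) = tnth v.2 k))).
  move=> w /asboolP[x Xx hx].
  exists ([tuple (x k%:Z : A) | k < m], [tuple (x (m + k)%N%:Z : A) | k < n]).
    apply/andP; split; apply/asboolP.
      by exists x => // k; rewrite tnth_mktuple.
    exists (sh m%:Z x); first exact: subshift_sh.
    by move=> k; rewrite tnth_mktuple /sh; congr (x _); lia.
  by split=> k; rewrite tnth_mktuple -hx.
move=> w w' v [h1 h2] [h1' h2']; apply: eq_from_tnth => k.
by case: (fintype.splitP k) => j kj;
  [rewrite (_ : k = lshift n j) ?h1 ?h1' | rewrite (_ : k = rshift m j) ?h2 ?h2'];
  rewrite //; apply: val_inj.
Qed.

Lemma nb_blocks_gt0 (A : finType) (X : set (fullshift A)) n :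
  X !=set0 -> (0 < nb_blocks X n)%N.
Proof.
move=> [x Xx]; rewrite /nb_blocks; apply/card_gt0P.
exists [tuple (x k%:Z : A) | k < n]; apply/asboolP; exists x => //.
by exists 0 => k; rewrite tnth_mktuple add0r.
Qed.

(** A block of the image of length [n] is determined by a block of length
    [n + 2 M], where the code reads windows of radius [M]. *)
Lemma nb_blocks_image (A B : finType) (X : set (fullshift A))
    (f : fullshift A -> fullshift B) : subshift X -> is_code X (f @` X) f ->
  exists K, forall n, (nb_blocks (f @` X) n <= K * nb_blocks X n)%N.
Proof.
move=> sX cf; have [M hM] := code_window sX cf.
exists (nb_blocks X (M + M)) => n; rewrite mulnC.
apply: leq_trans (nb_blocks_submul _ _ sX).
rewrite !nb_blocksE //; last exact: (code_image_subshift sX cf).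
apply: (@leq_card_rel _ _ _ _ (fun w v => exists2 x, X x &
  (forall k : 'I_n, f x k%:Z = tnth w k) /\
  (forall k : 'I_(n + (M + M)), x (k%:Z - M%:Z) = tnth v k))).
  move=> w /asboolP[_ [x Xx <-] hx].
  exists [tuple (x (k%:Z - M%:Z) : A) | k < n + (M + M)].
    apply/asboolP; exists (sh (- M%:Z) x); first exact: subshift_sh.
    by move=> k; rewrite tnth_mktuple.
  by exists x => //; split => // k; rewrite tnth_mktuple.
move=> w w' v [x Xx [h1 h2]] [x' Xx' [h1' h2']]; apply: eq_from_tnth => k.
rewrite -h1 -h1'.
have := hM 0%N _ _ (subshift_sh k%:Z sX Xx) (subshift_sh k%:Z sX Xx').
rewrite !(code_sh sX cf) // /sh => /(_ _ 0 isT); rewrite add0r; apply => i iM.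
have jn : (`|(i + k%:Z + M%:Z)%R| < n + (M + M))%N by have := ltn_ord k; lia.
have := h2 (Ordinal jn); have := h2' (Ordinal jn); rewrite /=.
rewrite (_ : `|(i + k%:Z + M%:Z)%R|%N%:Z - M%:Z = i + k%:Z); last by lia.
by move=> -> ->.
Qed.

Section Entropy.
Variable R : realType.

Definition block_rate (A : finType) (X : set (fullshift A)) (n : nat) : R :=
  ln (nb_blocks X n)%:R / n%:R.

Lemma block_rate_cvg (A : finType) (X : set (fullshift A)) :
  subshift X -> X !=set0 -> cvgn (block_rate X).
Proof.
move=> sX X0; apply: subadditive_cvg => [n|m n].
  by apply: ln_ge0; rewrite ler1n nb_blocks_gt0.
rewrite -lnM ?posrE ?ltr0n ?nb_blocks_gt0 // -natrM.
rewrite ler_ln ?posrE ?ltr0n ?muln_gt0 ?nb_blocks_gt0 //.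
by rewrite ler_nat nb_blocks_submul.
Qed.

(** The limit that defines the entropy exists, as the numbers of blocks of a
    nonempty subshift are positive and submultiplicative. *)
Lemma entropyE (A : finType) (X : set (fullshift A)) :
  subshift X -> X !=set0 -> entropy R X = (limn (block_rate X))%:E.
Proof.
move=> sX X0; rewrite -EFin_lim; last exact: block_rate_cvg.
rewrite /entropy; set u := (fun n : nat => _).
rewrite (_ : u = EFin \o block_rate X) //; apply/funext => n.
by rewrite /u lne_EFin ?ltr0n ?nb_blocks_gt0.
Qed.

Lemma entropy_image (A B : finType) (X : set (fullshift A))
    (f : fullshift A -> fullshift B) : subshift X -> is_code X (f @` X) f ->
  X !=set0 -> (entropy R (f @` X) <= entropy R X)%E.
Proof.
move=> sX cf X0; have [K hK] := nb_blocks_image sX cf.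
have sfX := code_image_subshift sX cf.
have fX0 : f @` X !=set0 by case: X0 => x Xx; exists (f x); exists x.
rewrite !entropyE // lee_fin.
have K0 : (0 < K)%N.
  have := leq_trans (nb_blocks_gt0 0%N fX0) (hK 0%N).
  by rewrite muln_gt0 => /andP[].
have inv0 : (fun n => ln K%:R / n%:R : R) @ \oo --> 0.
  rewrite -(mulr0 (ln K%:R)); apply: cvgMl_tmp.
  by apply/gtr0_cvgV0; [near=> n; rewrite ltr0n; near: n; exact: nbhs_infty_gt | exact: cvgr_idn].
have c1 := block_rate_cvg sX X0; have c2 := block_rate_cvg sfX fX0.
rewrite -[leRHS]addr0 -(cvg_lim _ inv0) // -limD //; last first.
  by apply/cvg_ex; exists 0.
apply: ler_lim => //.
  by apply: is_cvgD => //; apply/cvg_ex; exists 0.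
near=> n; change (block_rate (f @` X) n <= block_rate X n + ln K%:R / n%:R).
rewrite /block_rate -mulrDl ler_wpM2r ?invr_ge0 //.
rewrite addrC -lnM ?posrE ?ltr0n ?nb_blocks_gt0 // -natrM.
by rewrite ler_ln ?posrE ?ltr0n ?muln_gt0 ?K0 ?nb_blocks_gt0 // ler_nat.
Unshelve. all: by end_near.
Qed.

End Entropy.

(** * The extension theorem *)

Lemma entropy_lt_not_onto (R : realType) (A B : finType) (X : set (fullshift A))
    (Y : set (fullshift B)) phi : subshift X -> Y !=set0 -> is_code X Y phi ->
  (entropy R X < entropy R Y)%E -> exists2 y, Y y & forall x, X x -> phi x <> y.
Proof.
move=> sX Y0 cphi; apply: contraPP => h; apply/negP; rewrite -leNgt.
have eY : phi @` X = Y.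
  apply/seteqP; split => [_ [x Xx <-]|y Yy]; first exact: (code_in cphi).
  by apply: contrapT => hy; apply: h; exists y => // x Xx e; apply: hy; exists x.
rewrite -eY; apply: entropy_image => //; first by rewrite eY.
by case: Y0 => y; rewrite -eY => -[x Xx _]; exists x.
Qed.

Lemma card_eq_label (T : choiceType) n (S : set T) (q : T -> 'I_n) :
  {in S &, injective q} -> (forall s, exists2 x, S x & q x = s) -> S #= `I_n.
Proof.
move=> injq surq; have injv : {in S &, injective (fun x => q x : nat)}.
  by move=> x x' Sx Sx' /val_inj; exact: injq.
rewrite -(card_eql (inj_card_eq injv)).
suff -> : (fun x => q x : nat) @` S = `I_n by exact: card_eqxx.
apply/seteqP; split => [_ [x _ <-]|m /= mn]; first exact: ltn_ord.
by have [x Sx qx] := surq (Ordinal mn); exists x => //; rewrite qx.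
Qed.

Section Extension.
Variables (A B : finType) (X : set (fullshift A)) (Y : set (fullshift B)).
Variables (phi : fullshift A -> fullshift B) (n : nat).
Hypotheses (sX : subshift X) (Ysft : shift_of_finite_type Y) (Yirr : irreducible Y).
Hypotheses (cphi : is_code X Y phi) (closing : bi_closing X phi).
Hypothesis not_onto : exists2 y, Y y & forall x, X x -> phi x <> y.
Hypothesis fiber_le : forall y, Y y -> fiber X phi y #<= `I_n.+1.

(** A point [y0] outside the image of [phi] has a cylinder that misses this
    image. Recording membership in it along with the cocycle makes the edge of
    the presentation at [y0] one that no image of a point of [X] uses; changing
    the cocycle there keeps the embedding intact. *)
Lemma embed_in_skew : exists (G : digraph) (h : fullshift B -> fullshift (edge G))
    (c : edge G -> {perm 'I_n.+1}) (psi : fullshift A -> fullshift (edge (skew_graph c))),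
  [/\ conjugacy Y (edge_shift G) h, irreducible (edge_shift (skew_graph c)),
    is_code X (edge_shift (skew_graph c)) psi, {in X &, injective psi} &
    forall x, X x -> base (psi x) = h (phi x)].
Proof.
have [sY _] := Ysft; have [y0 Yy0 y0phi] := not_onto.
have Y0 : Y !=set0 by exists y0.
have [k [lk injk]] := fiber_labelling sX sY Y0 cphi closing fiber_le.
have [c0 [lc0 c0k]] := label_cocycle sX sY Y0 cphi lk injk.
have [M hM] := fiber_usc sX cphi y0 0%N.
have far x : X x -> ~ agree M y0 (phi x).
  by move=> Xx /(hM x Xx)[x' [[Xx' e] _]]; exact: y0phi Xx' e.
have [|G [h [g [ch hg ess]]]] :=
    @higher_block _ _ Y (fun y => (c0 y, `[< agree M y0 y >])) Ysft Y0.
  move=> y Yy; have [N hN] := lc0 y Yy; exists (maxn M N) => y' Yy' ag.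
  congr (_, _); first by apply: hN => //; apply: agreeW ag; exact: leq_maxr.
  have agM : agree M y y' by apply: agreeW ag; exact: leq_maxl.
  apply/asboolP/asboolP => a; first exact: agree_trans a agM.
  exact: agree_trans a (agree_sym agM).
have Girr := irreducible_image sY (edge_shift_subshift G) ch Yirr.
have hG y : Y y -> edge_shift G (h y) by move=> Yy; exact: (code_in ch.1).
have conn : forall e e' : edge G, connect (@adj G) e e'.
  apply: irreducible_connected => // e; have [y Yy <-] := ess e.
  by exists (h y) => //; exact: hG.
have pre (e : edge G) : exists e', adj e' e.
  have [y Yy <-] := ess e; exists (h y (-1)); apply/eqP; rewrite (hG y Yy).
  by congr (initial (h y _)); lia.
have suc (e : edge G) : exists e', adj e e'.
  have [y Yy <-] := ess e; exists (h y 1); apply/eqP; rewrite (hG y Yy).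
  by congr (initial (h y _)); lia.
have [c [cE cirr]] := skew_irreducible (fun e => (g e).1) (h y0 0) conn pre suc.
pose psi (x : fullshift A) : fullshift (edge (skew_graph c)) :=
  fun i => (h (phi x) i, k (sh i x)).
have hphi i x : X x -> h (phi x) i = h (phi (sh i x)) 0.
  move=> Xx; rewrite (code_sh sX cphi) // (code_sh sY ch.1); last exact: (code_in cphi).
  by rewrite /sh add0r.
have cpsi : is_code X (edge_shift (skew_graph c)) psi.
  apply: is_codeP => // [x Xx i|x Xx|j x Xx].
  - have Xi := subshift_sh i sX Xx; have Yi := code_in cphi Xi.
    rewrite /psi /= (hG _ (code_in cphi Xx)); congr (_, _).
    rewrite hphi // cE; first by rewrite -hg //= c0k // shD addrC.
    (* this edge records that [phi (sh i x)] is outside the cylinder of [y0] *)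
    apply/eqP => e; have := hg _ Yi; rewrite e -hg // => -[_ e'].
    by apply: (far _ Xi); apply/asboolP; rewrite e'; exact/asboolP/agree_refl.
  - have [N1 h1] := lk x Xx; have [N2 h2] := code_window sX cphi.
    have [N3 h3] := code_window sY ch.1.
    exists (maxn N1 (N3 + N2)) => x' Xx' ag; congr (_, _).
      apply: (h3 0%N) => //; [exact: (code_in cphi)|exact: (code_in cphi)|].
      by apply: h2 => //; apply: agreeW ag; exact: leq_maxr.
    by rewrite !sh0; apply: h1 => //; apply: agreeW ag; exact: leq_maxl.
  - apply/funext => i; rewrite /psi shD; congr (_, _).
    rewrite hphi; last exact: subshift_sh.
    by rewrite shD -hphi.
exists G, h, c, psi; split => // x x'; rewrite !inE => Xx Xx' e.
have hb : h (phi x) = h (phi x').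
  by apply/funext => i; move/funeqP: e => /(_ i)[].
apply: injk => //.
  by apply: (conjugacy_inj ch); rewrite ?inE //; exact: (code_in cphi).
by move/funeqP: e => /(_ 0)[_]; rewrite !sh0.
Qed.

(** The alphabet is enlarged by [embedding_as_inclusion], and the fibre over [y]
    is numbered by the sheet at [0]. *)
Lemma extension_exists : has_n_to_1_extension X Y phi n.+1.
Proof.
have [sY _] := Ysft; have [y0 Yy0 _] := not_onto.
have [G [h [c [psi [ch Zirr cpsi injpsi hpsi]]]]] := embed_in_skew.
have sG := edge_shift_subshift G; have sZ := edge_shift_subshift (skew_graph c).
have [A' [iota [X' [theta [injiota sX' ctheta thetaE]]]]] :=
  embedding_as_inclusion sX sZ cpsi injpsi.
have [z0 _ _] := Zirr.
have [theta' [ctheta' thetaK theta'K]] := conjugacy_inverse z0 sZ sX' ctheta.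
have [h' [ch' hK h'K]] := conjugacy_inverse y0 sY sG ch.
have X'theta z : edge_shift (skew_graph c) z -> X' (theta z) by exact: (code_in ctheta.1).
have theta'Z x' : X' x' -> edge_shift (skew_graph c) (theta' x') by exact: (code_in ctheta'.1).
have fiberE y z : Y y -> edge_shift (skew_graph c) z -> base z = h y ->
    h' (base (theta' (theta z))) = y.
  by move=> Yy hz e; rewrite thetaK // e hK.
have points y s : Y y -> exists2 x', fiber X' (h' \o @base G n c \o theta') y x' &
    (theta' x' 0).2 = s.
  move=> Yy; have [z hz [bz zs]] := skew_point_exists c s (code_in ch.1 Yy).
  exists (theta z); last by rewrite thetaK.
  by split; [exact: X'theta|exact: fiberE].
exists A', iota, X', (h' \o @base G n c \o theta'); split.
- by split => // x Xx; rewrite -thetaE //; apply/X'theta/(code_in cpsi).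
- split; last exact: irreducible_image ctheta Zirr.
  by split => //; exists (skew_graph c), theta'.
- apply: (code_comp sX' sZ ctheta'.1).
  exact: (code_comp sZ sG (base_code c) ch'.1).
- split => [y Yy|y Yy]; last first.
    by have [x' [X'x' e] _] := points y ord0 Yy; exists x'.
  apply: (@card_eq_label _ _ _ (fun x' => (theta' x' 0).2)) => [x x'|s].
    rewrite !inE => -[Xx /= ex] [Xx' /= ex'] e.
    have [Zx Zx'] := (theta'Z _ Xx, theta'Z _ Xx').
    apply: (conjugacy_inj ctheta'); rewrite ?inE //.
    apply: skew_point_eq e => //; apply: (conjugacy_inj ch').
    + by rewrite inE; exact: (code_in (base_code c)).
    + by rewrite inE; exact: (code_in (base_code c)).
    + by rewrite ex ex'.
  exact: points.
- move=> x Xx; rewrite /= -thetaE //; apply: fiberE (hpsi x Xx).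
  + exact: (code_in cphi).
  + exact: (code_in cpsi).
Qed.

End Extension.

Theorem theorem4p3 (R : realType) (A B : finType)
    (X : set (fullshift A)) (Y : set (fullshift B))
    (phi : fullshift A -> fullshift B)
    (hX : subshift X)
    (hY : shift_of_finite_type Y) (hYirr : irreducible Y)
    (hent : (entropy R X < entropy R Y)%E)
    (hphi : is_code X Y phi) (hclosing : bi_closing X phi) :
  exists d : nat, max_fiber_card X Y phi d /\
    [/\ shift_of_finite_type X -> indecomposable X ->
          forall n : nat, (0 < n)%N -> (d <= n)%N ->
            has_n_to_1_extension X Y phi n,
        shift_of_finite_type X ->
          forall n : nat, (d + 1 <= n)%N -> has_n_to_1_extension X Y phi n
      & exists2 m : nat, (d <= m)%N &
          forall n : nat, (m <= n)%N -> has_n_to_1_extension X Y phi n].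
Proof.
have Y0 : Y !=set0 by case: hYirr => y Yy _; exists y.
have [d hd] := max_fiber_card_exists hX hphi hclosing Y0.
have ext n : (0 < n)%N -> (d <= n)%N -> has_n_to_1_extension X Y phi n.
  case: n => // n _ dn; apply: extension_exists => //.
    exact: entropy_lt_not_onto hent.
  by move=> y Yy; apply: card_le_trans (hd.2 y Yy) _; rewrite card_le_II.
exists d; split => //; split => [_ _ //|_ n dn|]; first by apply: ext; lia.
by exists d.+1 => // n dn; apply: ext; lia.
Qed.
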